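(* Let $p \geq 1$ and $s_1, s_2 \geq 1$ be integers. Let $b_n = b_n^{(s_1)}$ ($n \geq -2$) be the sequence defined by $b_n = b_{n-1} + b_{n-2}$ for $n \geq 0$, with $b_{-2} = 2^{s_1}$ and $b_{-1} = 2^{s_1-1}(s_1+2)$. Define $$t(p,s_1,s_2) := 2^{s_2-1}\left(2b_{2p-3}^{(s_1)} + s_2\, b_{2p-4}^{(s_1)}\right).$$ Then the number of spanning trees of the cone over the bi-coconut tree $T(p,s_1,s_2)$ is $$\tau(\mathrm{Cone}(T(p,s_1,s_2))) = t(p,s_1,s_2).$$
   Context: For a graph $G$ on vertex set $\{v_1,\dots,v_n\}$, the cone $\mathrm{Cone}(G)$ is obtained by adding a new vertex $v_0$ and one edge $\{v_0,v_i\}$ for each $i=1,\dots,n$. For positive integers $p, s_1, s_2$, the bi-coconut tree $T(p,s_1,s_2)$ is obtained from a path on $p$ vertices $\pi_1,\dots,\pi_p$ by attaching $s_1$ new leaf vertices to the endvertex $\pi_1$ and $s_2$ new leaf vertices to the endvertex $\pi_p$ (when $p=1$, all $s_1+s_2$ leaves are attached to the single path vertex). $\tau(G)$ denotes the number of spanning trees of $G$. *)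

(* Defs.v *)
From mathcomp Require Import all_boot all_order all_algebra.

Set Implicit Arguments.
Unset Strict Implicit.
Unset Printing Implicit Defensive.

Import GRing.Theory.

Record sgraph := SGraph {
  vertex :> finType;
  adj : rel vertex;
  adj_sym : symmetric adj;
  adj_irrefl : irreflexive adj
}.

Section SpanningTrees.

Variable G : sgraph.

Definition edges : {set {set G}} := [set [set x; y] | x in G, y in adj x].

Definition edge_rel (F : {set {set G}}) : rel G :=
  [rel x y | (x != y) && ([set x; y] \in F)].

Definition connected_by (F : {set {set G}}) : bool :=
  [forall x : G, forall y : G, connect (edge_rel F) x y].

(* A cycle repeats no vertex, so bounding its length by #|G| loses nothing;   *)
(* the bound only serves to keep the predicate boolean.                       *)
Definition acyclic (F : {set {set G}}) : bool :=
  [forall n : 'I_#|G|.+1, forall c : n.-tuple G,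
     (2 < n) ==> ~~ ucycleb (edge_rel F) c].

Definition spanning_tree (F : {set {set G}}) : bool :=
  [&& F \subset edges, connected_by F & acyclic F].

Definition tau : nat := #|[set F : {set {set G}} | spanning_tree F]|.

End SpanningTrees.

Lemma acyclicP (G : sgraph) (F : {set {set G}}) :
  reflect (forall c : seq G, 2 < size c -> ~ ucycle (edge_rel F) c)
          (acyclic F).
Proof.
apply: (iffP forallP) => [H c c2 uc | H n].
  have cG : size c < #|G|.+1.
    by case/andP: uc => _ /card_uniqP <-; apply: max_card.
  move/forallP: (H (Ordinal cG)) => /(_ (in_tuple c)) /implyP /(_ c2).
  by apply/negP; rewrite negbK.
apply/forallP => c; apply/implyP => n2; apply/negP.
by apply: H; rewrite size_tuple.
Qed.

Section Cone.

Variable G : sgraph.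

Definition cone_adj : rel (option G) := fun u v =>
  match u, v with
  | Some x, Some y => adj x y
  | None, None => false
  | _, _ => true
  end.

Lemma cone_adj_sym : symmetric cone_adj.
Proof. by case=> [x|] [y|] //=; apply: adj_sym. Qed.

Lemma cone_adj_irrefl : irreflexive cone_adj.
Proof. by case=> [x|] //=; apply: adj_irrefl. Qed.

Definition Cone : sgraph := SGraph cone_adj_sym cone_adj_irrefl.

End Cone.

Section BiCoconut.

Variables p s1 s2 : nat.

(* inl (inl i) is the path vertex pi_(i+1); inl (inr _) and inr _ are the     *)
(* leaves attached to pi_1 and to pi_p respectively.                          *)
Definition bicoconut_vertex : finType := ('I_p + 'I_s1 + 'I_s2)%type.

(* Each edge in exactly one orientation. *)
Definition bicoconut_arc : rel bicoconut_vertex := fun u v =>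
  match u, v with
  | inl (inl i), inl (inl j) => i.+1 == j
  | inl (inl i), inl (inr _) => i == 0 :> nat
  | inl (inl i), inr _ => i.+1 == p
  | _, _ => false
  end.

Definition bicoconut_adj : rel bicoconut_vertex :=
  fun u v => bicoconut_arc u v || bicoconut_arc v u.

Lemma bicoconut_adj_sym : symmetric bicoconut_adj.
Proof. by move=> u v; rewrite /bicoconut_adj orbC. Qed.

Lemma bicoconut_adj_irrefl : irreflexive bicoconut_adj.
Proof.
by case=> [[i|a]|b]; rewrite /bicoconut_adj //= orbb gtn_eqF.
Qed.

Definition bicoconut : sgraph := SGraph bicoconut_adj_sym bicoconut_adj_irrefl.

End BiCoconut.

(* (b_(k-2), b_(k-1)) *)
Fixpoint b_pair (s1 k : nat) : nat * nat :=
  if k is k'.+1 then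
    let: (x, y) := b_pair s1 k' in (y, y + x)
  else (2 ^ s1, 2 ^ (s1 - 1) * (s1 + 2)).

(* b_n for n >= -2; meaningless for smaller n. *)
Definition b (s1 : nat) (n : int) : nat := (b_pair s1 `|(n + 2)%R|%N).1.

Lemma b_m2 s1 : b s1 (- 2)%R = 2 ^ s1.
Proof. by []. Qed.

Lemma b_m1 s1 : b s1 (- 1)%R = 2 ^ (s1 - 1) * (s1 + 2).
Proof. by []. Qed.

Lemma b_rec s1 (n : int) : (0 <= n)%R ->
  b s1 n = b s1 (n - 1)%R + b s1 (n - 2)%R.
Proof.
case: n => // n _; rewrite /b subrK.
have -> : (n%:Z - 1 + 2 = n.+1%:Z)%R by rewrite -addrA -(addn1 n) PoszD.
rewrite -PoszD addn2 /=.
by case: (b_pair s1 n) => x y.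
Qed.

Definition t (p s1 s2 : nat) : nat :=
  2 ^ (s2 - 1) * (2 * b s1 (2 * p%:Z - 3)%R + s2 * b s1 (2 * p%:Z - 4)%R).

(* Main.v *)
(** A spanning tree is a minimal connected edge set, so exchanging edges that
preserve connectivity transports spanning trees. Grow the base graph G one leaf
at a time: for a set D of vertices of G, let T(D) count the spanning trees of
Cone(G) in which every vertex outside D is joined to the apex only, and let
A_v(D) count those that contain the edge from v to the apex. When a vertex u
whose unique neighbour in D is v is added, the tree uses the edge from u to the
apex, the edge uv, or both; the last case corresponds to the edge from v to the
apex being subdivided by u. Hence T(D+u) = 2 T(D) + A_v(D),
A_v(D+u) = 2 A_v(D) and A_u(D+u) = T(D) + A_v(D). After the first bunch of
leaves (A, T) = (b_{-2}, b_{-1}), each new path vertex advances the Fibonacci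
recurrence by two steps, and the second bunch of leaves gives the formula. *)

Require Import Defs.
From mathcomp Require Import all_boot all_order all_algebra.
From mathcomp Require Import zify.

Set Implicit Arguments.
Unset Strict Implicit.
Unset Printing Implicit Defensive.

(** * Paths, two-element sets, and counting by exchange of one element *)

Lemma connect_map (T U : finType) (e : rel T) (e' : rel U) (h : T -> U) :
  (forall x y, e x y -> connect e' (h x) (h y)) ->
  forall x y, connect e x y -> connect e' (h x) (h y).
Proof.
move=> he x y /connectP[p]; elim: p x => [|z p IHp] x /=; first by move=> _ ->.
by case/andP=> exz pzp yE; apply: connect_trans (he _ _ exz) (IHp _ pzp yE).
Qed.

Lemma eq_set2 (T : finType) (x y z w : T) :
  [set x; y] = [set z; w] -> (x = z /\ y = w) \/ (x = w /\ y = z).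
Proof.
move=> /setP E; have [xz|xz] := eqVneq x z.
  left; split=> //; apply/eqP; move: (E y) (E w); rewrite -xz !inE !eqxx !orbT.
  have [->|_ /= <- //] := eqVneq y x.
  by rewrite orbb eq_sym => _ ->.
right; move: (E x) (E z); rewrite !inE !eqxx (negPf xz) (eq_sym z x) (negPf xz).
by move=> /= /esym/eqP -> /eqP ->.
Qed.

Lemma setU1D1 (T : finType) (a c : T) (A : {set T}) :
  c != a -> (a |: A) :\ c = a |: (A :\ c).
Proof.
move=> ca; apply/setP=> x; rewrite !inE.
by have [->|//] := eqVneq x a; rewrite eq_sym ca.
Qed.

(** Trading [e] for [e'] is a bijection between the two families. Every edge exchange below is
    counted this way, with [F] the part of the tree that does not change. *)
Lemma card_swap (T : finType) (e e' : T) (P Q : pred {set T}) :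
  (forall F : {set T}, P F -> (e \in F) && (e' \notin F)) ->
  (forall F : {set T}, Q F -> (e' \in F) && (e \notin F)) ->
  (forall F : {set T}, e \notin F -> e' \notin F -> P (e |: F) = Q (e' |: F)) ->
  #|[set F | P F]| = #|[set F | Q F]|.
Proof.
move=> Pe Qe PQ.
have E (F : {set T}) : e \in F -> e' \notin F -> P F = Q (e' |: F :\ e).
  move=> eF e'F; rewrite -PQ ?setD1K // in_setD1 ?eqxx //.
  by rewrite (negPf e'F) andbF.
have inj : {in [set F | P F] &, injective (fun F => e' |: F :\ e)}.
  move=> F1 F2; rewrite !inE => /Pe/andP[e1 e1'] /Pe/andP[e2 e2'] E12.
  rewrite -(setD1K e1) -(setD1K e2); congr (_ |: _).
  rewrite -(@setU1K _ e' (F1 :\ e)) ?E12 ?setU1K //.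
    by rewrite in_setD1 (negPf e2') andbF.
  by rewrite in_setD1 (negPf e1') andbF.
rewrite -(card_in_imset inj); congr #|pred_of_set _|.
apply/setP=> F; rewrite inE; apply/imsetP/idP => [[F1]|QF].
  by rewrite inE => PF1 ->; case/andP: (Pe _ PF1) => eF1 e'F1; rewrite -E.
have /andP[e'F eF] := Qe _ QF.
have eF' : e \notin F :\ e' by rewrite in_setD1 (negPf eF) andbF.
exists (e |: F :\ e'); last by rewrite setU1K // setD1K.
by rewrite inE PQ ?setD1K // in_setD1 eqxx.
Qed.

(** * Spanning trees as minimal connected edge sets, and edge exchanges *)

Section Connectivity.

Variable G : sgraph.
Implicit Types (F : {set {set G}}) (x y u v w : G).

Lemma mem_edges x y : ([set x; y] \in edges G) = adj x y.
Proof.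
apply/imset2P/idP => [[z w _ /= zw /eq_set2]|xy]; last by exists x y.
have {}zw : adj z w := zw.
by case=> -[-> ->] //; rewrite adj_sym.
Qed.

Lemma edge_relE F x y :
  edge_rel F x y = (x != y) && ([set x; y] \in F).
Proof. by []. Qed.

Lemma edge_rel_sym F : symmetric (edge_rel F).
Proof. by move=> x y; rewrite !edge_relE eq_sym setUC. Qed.

Lemma connect_edge_sym F x y :
  connect (edge_rel F) x y = connect (edge_rel F) y x.
Proof. exact: (sym_connect_sym (@edge_rel_sym F)). Qed.

Lemma connect_edge F x y : [set x; y] \in F -> connect (edge_rel F) x y.
Proof.
case: (eqVneq x y) => [-> _|xy xyF]; first exact: connect0.
by apply: connect1; rewrite edge_relE xy.
Qed.

Lemma connected_byP F :
  reflect (forall x y, connect (edge_rel F) x y) (connected_by F).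
Proof.
by apply: (iffP forallP) => H x; [move=> y; apply/forallP | apply/forallP=> y].
Qed.

Lemma connected_by_sub F F' :
  (forall x y, x != y -> [set x; y] \in F -> connect (edge_rel F') x y) ->
  connected_by F -> connected_by F'.
Proof.
move=> FF' /connected_byP cF; apply/connected_byP => x y.
apply: (connect_map (h := id)) (cF x y) => {x y}x y /andP[]; exact: FF'.
Qed.

Lemma connected_by_isolated F u v :
  u != v -> (forall w, [set u; w] \notin F) -> ~~ connected_by F.
Proof.
move=> uv uF; apply/connected_byP => /(_ u v) /connectP[[|w p] /=].
  by move=> _ vu; rewrite vu eqxx in uv.
by rewrite edge_relE (negPf (uF w)) andbF.
Qed.

(** The right-hand side does not mention [v]: this is what allows a pendant edge at [u] to be
    reattached anywhere. *)
Lemma connected_by_pendant F u v :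
  u != v -> (forall w, [set u; w] \notin F) ->
  connected_by ([set u; v] |: F) <->
  (forall x y, x != u -> y != u -> connect (edge_rel F) x y).
Proof.
move=> uv uF; split=> [/connected_byP cF x y xu yu|cF].
  (* Contracting the pendant edge onto [v] maps walks to walks that avoid [u]. *)
  pose h z := if z == u then v else z.
  have -> : x = h x by rewrite /h (negPf xu).
  have -> : y = h y by rewrite /h (negPf yu).
  apply: (connect_map _ (cF x y)) => {xu yu}z w /andP[zw].
  rewrite in_setU1 => /orP[/eqP/eq_set2[] [-> ->]|zwF].
  - by rewrite /h eqxx; case: ifP.
  - by rewrite /h eqxx; case: ifP.
  rewrite /h; case: eqP => [zu|_]; first by rewrite zu (negPf (uF _)) in zwF.
  case: eqP => [wu|_]; last exact: connect_edge.
  by rewrite wu setUC (negPf (uF _)) in zwF.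
have sub : subrel (connect (edge_rel F)) (connect (edge_rel ([set u; v] |: F))).
  apply: connect_sub => x y /andP[_ xyF]; apply: connect_edge.
  by rewrite in_setU1 xyF orbT.
have cuv : connect (edge_rel ([set u; v] |: F)) u v.
  by apply: connect_edge; rewrite setU11.
have cv x : connect (edge_rel ([set u; v] |: F)) x v.
  by case: (eqVneq x u) => [->|xu] //; apply/sub/cF => //; rewrite eq_sym.
apply/connected_byP => x y; apply: connect_trans (cv x) _.
by rewrite connect_edge_sym.
Qed.

Lemma connected_by_pendant_swap F u v w :
  u != v -> u != w -> (forall x, [set u; x] \notin F) ->
  connected_by ([set u; v] |: F) = connected_by ([set u; w] |: F).
Proof.
move=> uv uw uF; apply/idP/idP.
  by move/(connected_by_pendant uv uF)/(connected_by_pendant uw uF).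
by move/(connected_by_pendant uw uF)/(connected_by_pendant uv uF).
Qed.

(** The lost edge [uv] is replaced by the detour from [u] through [w] to [v]. *)
Lemma connected_by_triangle_sub F u v w :
  [set u; w] \in F ->
  connected_by ([set u; v] |: F) -> connected_by ([set v; w] |: F).
Proof.
move=> uwF; apply: connected_by_sub => x y _; rewrite in_setU1.
have cuv : connect (edge_rel ([set v; w] |: F)) u v.
  apply: (@connect_trans _ _ w).
    by apply: connect_edge; rewrite in_setU1 uwF orbT.
  by rewrite connect_edge_sym; apply: connect_edge; rewrite setU11.
case/orP=> [/eqP/eq_set2[] [-> ->]|xyF] //; first by rewrite connect_edge_sym.
by apply: connect_edge; rewrite in_setU1 xyF orbT.
Qed.

Lemma connected_by_triangle F u v w :
  [set u; w] \in F ->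
  connected_by ([set u; v] |: F) = connected_by ([set v; w] |: F).
Proof.
move=> uwF; apply/idP/idP; first exact: connected_by_triangle_sub.
rewrite (setUC [set v]) (setUC [set u]).
by apply: connected_by_triangle_sub; rewrite setUC.
Qed.

(** An edge is redundant for connectivity exactly when it lies on a cycle. Minimality is easier to
    carry through an exchange than acyclicity. *)
Lemma spanning_tree_minimal F :
  spanning_tree F <->
  [/\ F \subset edges G, connected_by F &
      forall e, e \in F -> ~~ connected_by (F :\ e)].
Proof.
split.
  case/and3P=> sF cF /acyclicP aF; split=> // e eF.
  have /imset2P[x y _ xy eE] := subsetP sF _ eF.
  have {}xy : adj x y := xy.
  apply/negP => /connected_byP /(_ y x) /connectP[p].
  case/shortenP=> q qpath quniq _ xE.
  have nxy : x != y by apply: contraTneq xy => ->; rewrite adj_irrefl.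
  (* A simple path from [y] to [x] avoiding [e] is closed into a cycle by [e]; it has at least three
     vertices, since a one-edge path would be [e] itself. *)
  apply: (aF (y :: q)).
    case: q xE qpath {quniq} => [|z [|z' q]] //=.
      by move=> xy'; rewrite xy' eqxx in nxy.
    by move=> <-; rewrite edge_relE in_setD1 eE setUC eqxx /= andbF.
  rewrite /ucycle /ucycleb quniq andbT /= rcons_path -xE.
  rewrite edge_relE nxy -eE eF /= andbT.
  apply: sub_path qpath => z w.
  by rewrite !edge_relE in_setD1 => /and3P[-> _ ->].
case=> sF cF mF; rewrite /spanning_tree sF cF /=; apply/acyclicP.
case=> [|x [|y c]] // c0 /andP[/= cyc /and3P[xc yc uc]].
have /andP[/andP[nxy xyF] pc] := cyc.
have /negP[] := mF _ xyF; apply: connected_by_sub cF => z w nzw zwF.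
case: (eqVneq [set z; w] [set x; y]) => [E|nE]; last first.
  by apply: connect_edge; rewrite in_setD1 nE.
(* The rest of the cycle bypasses its first edge [xy]. *)
have cyx : connect (edge_rel (F :\ [set x; y])) y x.
  apply/connectP; exists (rcons c x); last by rewrite last_rcons.
  move: pc c0; rewrite !rcons_path => /andP[pc lc] c0.
  apply/andP; split.
    (* Edges inside [y :: c] avoid [x], hence differ from [xy]; only the closing edge back to [x]
       needs its own argument. *)
    apply: (sub_in_path (P := predC1 x)) pc; last first.
      move: xc; rewrite inE negb_or eq_sym => /andP[yx xc] /=.
      rewrite yx /=; apply/allP => s sc /=; apply: contraNneq xc => <-.
      exact: sc.
    move=> s s' /= sx s'x /andP[ss' ss'F];
    rewrite edge_relE ss' in_setD1 ss'F andbT /=.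
    apply: contraNneq sx => /setP/(_ x); rewrite !inE eqxx /= => /esym.
    by rewrite !(eq_sym x) (negPf s'x) orbF.
  move: lc => /andP[nl lF]; rewrite edge_relE nl in_setD1 lF andbT /=.
  apply/eqP => /eq_set2[] [E1 E2].
    by rewrite E1 eqxx in nl.
  (* The length bound makes [c] nonempty, so its last vertex cannot be [y]. *)
  case: c c0 yc E1 {pc uc xc lF nl cyc} => // s c _ /= yc E1.
  by rewrite -E1 mem_last in yc.
by case/eq_set2: E => -[-> ->] //; rewrite connect_edge_sym.
Qed.

(** Deleting another edge leaves [u] pendant, so the connectivity swap applies before and after the
    deletion; deleting the pendant edge isolates [u]. *)
Lemma spanning_tree_pendant_swap F u v w :
  adj u v -> adj u w -> (forall x, [set u; x] \notin F) ->
  spanning_tree ([set u; v] |: F) = spanning_tree ([set u; w] |: F).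
Proof.
move=> uv uw uF.
suff H a c : adj u a -> adj u c ->
    spanning_tree ([set u; a] |: F) -> spanning_tree ([set u; c] |: F).
  by apply/idP/idP; apply: H.
move=> ua uc /spanning_tree_minimal[sF cF mF]; apply/spanning_tree_minimal.
have nua : u != a by apply: contraTneq ua => ->; rewrite adj_irrefl.
have nuc : u != c by apply: contraTneq uc => ->; rewrite adj_irrefl.
have sF' : F \subset edges G by apply: subset_trans sF; apply: subsetUr.
split.
- by rewrite subUset sub1set mem_edges uc.
- by rewrite (connected_by_pendant_swap nuc nua).
move=> e; have [-> _|ne] := eqVneq e [set u; c].
  by rewrite setU1K //; apply: connected_by_isolated nuc uF.
rewrite in_setU1 (negPf ne) /= => eF.
have nea : e != [set u; a] by apply: contraTneq eF => ->.
have uFe x : [set u; x] \notin F :\ e by rewrite in_setD1 (negPf (uF x)) andbF.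
rewrite setU1D1 // (connected_by_pendant_swap nuc nua uFe) -setU1D1 //.
by apply: mF; rewrite in_setU1 eF orbT.
Qed.

(** On the left [u] subdivides an edge from [v] to [w]; on the right that edge is restored and [u]
    hangs as a leaf at [w]. *)
Lemma spanning_tree_triangle F u v w :
  adj u v -> adj v w -> [set u; w] \in F ->
  [set u; v] \notin F -> [set v; w] \notin F ->
  (forall x, [set u; x] \notin F :\ [set u; w]) ->
  spanning_tree ([set u; v] |: F) = spanning_tree ([set v; w] |: F).
Proof.
move=> uv vw uwF uvF vwF uF.
have nuv : u != v by apply: contraTneq uv => ->; rewrite adj_irrefl.
(* As long as [uw] survives the deletion, the triangle exchange still applies. *)
have conE e : e \in F -> e != [set u; w] ->
    connected_by (([set u; v] |: F) :\ e) =
    connected_by (([set v; w] |: F) :\ e).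
  move=> eF ne; rewrite !setU1D1; first last.
  - by apply: contraNneq uvF => <-.
  - by apply: contraNneq vwF => <-.
  by apply: connected_by_triangle; rewrite in_setD1 eq_sym ne.
apply/idP/idP => /spanning_tree_minimal[]; rewrite subUset => /andP[_ sF] cF mF;
  apply/spanning_tree_minimal;
  (split; first by rewrite subUset sub1set mem_edges ?uv ?vw).
- by rewrite -(connected_by_triangle _ uwF).
- have ncF : ~~ connected_by F.
    by rewrite -(setU1K uvF); apply: mF; rewrite setU11.
  move=> e; rewrite in_setU1 => /orP[/eqP ->|eF]; first by rewrite setU1K.
  (* Without [uw] nothing touches [u]: the new edge [vw] does not contain it. *)
  have [->|ne] := eqVneq e [set u; w].
    apply: (connected_by_isolated nuv) => x.
    have := uF x; rewrite !in_setD1 in_setU1.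
    case: (_ =P _) => //= _ /negPf ->; rewrite orbF.
    apply/eqP => /eq_set2[] [uE _]; first by rewrite uE eqxx in nuv.
    by have := subsetP sF _ uwF; rewrite mem_edges uE adj_irrefl.
  by rewrite -conE // mF // in_setU1 eF orbT.
- by rewrite (connected_by_triangle _ uwF).
have ncF : ~~ connected_by F.
  by rewrite -(setU1K vwF); apply: mF; rewrite setU11.
move=> e; rewrite in_setU1 => /orP[/eqP ->|eF]; first by rewrite setU1K.
have [->|ne] := eqVneq e [set u; w].
  have nuw : u != w.
    by apply: contraTneq (subsetP sF _ uwF) => ->; rewrite mem_edges adj_irrefl.
  rewrite setU1D1; last by apply: contraNneq uvF => <-.
  (* After deletion of [uw], the edge [uv] is pendant; moving it back to [uw] gives [F], which is
     disconnected. *)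
  by rewrite (connected_by_pendant_swap nuv nuw uF) setD1K.
by rewrite conE // mF // in_setU1 eF orbT.
Qed.

End Connectivity.

(** * Spanning trees of a cone whose non-apex edges stay inside a set [D] *)

Section ConeTrees.

Variable G : sgraph.
Implicit Types (u v w y : G) (D : {set G}) (F : {set {set Cone G}}).

Definition spoke v : {set Cone G} := [set Some v; None].

Definition rim u v : {set Cone G} := [set Some u; Some v].

(** Since [y] is arbitrary and rim edges are unordered, both ends of a rim edge in [F] must lie in
    [D]. *)
Definition rim_within D F :=
  [forall w, forall y, (w \notin D) ==> (rim w y \notin F)].

Definition cone_trees D : {set {set {set Cone G}}} :=
  [set F | spanning_tree F & rim_within D F].

Lemma rim_withinP D F :
  reflect (forall w y, w \notin D -> rim w y \notin F) (rim_within D F).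
Proof.
apply: (iffP forallP) => H w.
  by move=> y wD; have /forallP/(_ y)/implyP := H w; apply.
by apply/forallP=> y; apply/implyP; apply: H.
Qed.

Lemma rimC u v : rim u v = rim v u.
Proof. exact: setUC. Qed.

Lemma spoke_neq_rim w u v : spoke w != rim u v.
Proof. by apply/eqP => /eq_set2[] []. Qed.

Lemma spoke_inj : injective spoke.
Proof. by move=> v w /eq_set2[] [] // []. Qed.

Lemma rim_within_spoke D F w : rim_within D (spoke w |: F) = rim_within D F.
Proof.
apply: eq_forallb => x; apply: eq_forallb => y.
by rewrite in_setU1 eq_sym (negPf (spoke_neq_rim _ _ _)).
Qed.

Lemma rim_within_isolated D F u :
  u \notin D -> rim_within D F -> spoke u \notin F ->
  forall x : Cone G, [set Some u; x] \notin F.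
Proof. by move=> uD /rim_withinP DF uF [y|] //; apply: DF. Qed.

(** Without its spoke, [u] would be isolated. *)
Lemma cone_trees_spoke D F u : u \notin D -> F \in cone_trees D -> spoke u \in F.
Proof.
move=> uD; rewrite inE => /andP[/and3P[_ cF _] DF]; apply: contraTT cF => uF.
exact: (@connected_by_isolated _ _ (Some u : Cone G) None)
  (rim_within_isolated uD DF uF).
Qed.

(** * Adding to [D] a vertex [u] whose only neighbour in [D] is [v] *)

Section AddLeaf.

Variables (D : {set G}) (u v : G).
Hypotheses (uD : u \notin D) (vD : v \in D) (uv : adj u v).
Hypothesis u_leaf : forall y, y \in D -> adj u y -> y = v.

(** The only rim edge at [u] that [u |: D] newly permits is [uv]. *)
Lemma rim_within_leaf F :
  F \subset edges (Cone G) ->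
  rim_within D F = rim_within (u |: D) F && (rim u v \notin F).
Proof.
move=> sF; apply/rim_withinP/andP => [DF|[/rim_withinP DF uvF] w y wD].
  split; last exact: DF.
  by apply/rim_withinP => w y; rewrite in_setU1 negb_or => /andP[_]; apply: DF.
have [wu|wu] := eqVneq w u; last by apply: DF; rewrite in_setU1 negb_or wu.
rewrite {}wu {wD}; apply/negP => uyF.
have uy : adj u y by have := subsetP sF _ uyF; rewrite mem_edges.
have [/u_leaf yv|yD] := boolP (y \in D); first by rewrite -yv // uyF in uvF.
have yu : y != u by apply: contraTneq uy => ->; rewrite adj_irrefl.
have yuD : y \notin u |: D by rewrite in_setU1 negb_or yu.
by have := DF y u yuD; rewrite rimC uyF.
Qed.

Lemma rim_within_leaf_rim F :
  rim_within (u |: D) (rim u v |: F) = rim_within (u |: D) F.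
Proof.
apply: eq_forallb => w; apply: eq_forallb => y; rewrite (in_setU1 (rim w y)) negb_or.
case: (boolP (w \in u |: D)) => //= wD; case: eqP => //= /eq_set2[] [] [wE] _.
  by rewrite wE setU11 in wD.
by rewrite wE in_setU1 vD orbT in wD.
Qed.

Lemma cone_trees_leaf F :
  (F \in cone_trees D) = (F \in cone_trees (u |: D)) && (rim u v \notin F).
Proof.
rewrite !inE -andbA; case: (boolP (spanning_tree F)) => //= /and3P[sF _ _].
exact: rim_within_leaf.
Qed.

(** Here [u] is a leaf attached at [v], and its edge is moved to the apex. The predicate [R] records
    a side condition, such as the presence of the spoke at [v]. *)
Lemma card_cone_trees_rim (R : pred {set {set Cone G}}) :
  (forall F, R (rim u v |: F) = R (spoke u |: F)) ->
  #|[set F in cone_trees (u |: D) |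
      [&& rim u v \in F, spoke u \notin F & R F]]| =
  #|[set F in cone_trees D | R F]|.
Proof.
move=> RE; apply: (@card_swap _ (rim u v) (spoke u)) => F.
- by case/and4P=> _ -> ->.
- case/andP=> FD _; rewrite (cone_trees_spoke uD FD).
  by move: FD; rewrite cone_trees_leaf => /andP[_ ->].
move=> uvF uF; rewrite RE setU11 !in_setU1 (negPf (spoke_neq_rim _ _ _)) uF /=.
congr (_ && _); rewrite !inE rim_within_spoke.
have [sF|sF] := boolP (F \subset edges (Cone G)); last first.
  by rewrite /spanning_tree !subUset (negPf sF) !andbF.
rewrite rim_within_leaf_rim rim_within_leaf // uvF andbT.
have [DF|] := boolP (rim_within (u |: D) F); last by rewrite !andbF.
rewrite !andbT; apply: spanning_tree_pendant_swap => //.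
by apply: (@rim_within_isolated D) => //; rewrite rim_within_leaf // DF uvF.
Qed.

Lemma spanning_tree_no_triangle F :
  spanning_tree F -> rim u v \in F -> spoke u \in F -> spoke v \notin F.
Proof.
case/and3P=> _ _ /acyclicP aF uvF uF; apply/negP=> vF.
apply: (aF [:: Some u; Some v; None]) => //.
have nuv : u != v by apply: contraNneq uD => ->.
rewrite /ucycle /ucycleb /= !edge_relE -/(rim u v) -/(spoke v) uvF vF setUC.
rewrite -/(spoke u) uF !inE /= !andbT /eq_op /= nuv.
by rewrite orbF nuv.
Qed.

(** The path from [v] through [u] to the apex is exchanged for the spoke at [v], keeping the spoke
    at [u]. *)
Lemma card_cone_trees_triangle :
  #|[set F in cone_trees (u |: D) | (rim u v \in F) && (spoke u \in F)]| =
  #|[set F in cone_trees D | spoke v \in F]|.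
Proof.
apply: (@card_swap _ (rim u v) (spoke v)) => F.
- case/and3P=> FD uvF uF; rewrite uvF /=; apply: spanning_tree_no_triangle => //.
  by move: FD; rewrite inE => /andP[].
- by case/andP=> + ->; rewrite cone_trees_leaf => /andP[_ ->].
move=> uvF vF; rewrite !setU11 !in_setU1 (negPf (spoke_neq_rim _ _ _)) /= andbT.
have nuv : u != v by apply: contraNneq uD => ->.
have [uF|uF] := boolP (spoke u \in F); rewrite ?andbF ?andbT; last first.
  (* If [F] lacks the spoke at [u], the left side fails outright, and the right side fails because
     [u] lies outside [D]. *)
  apply/esym/negP => /(cone_trees_spoke uD).
  by rewrite in_setU1 (negPf uF) orbF (inj_eq spoke_inj) (negPf nuv).
have [sF|sF] := boolP (F \subset edges (Cone G)); last first.
  by rewrite !inE /spanning_tree !subUset (negPf sF) !andbF.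
rewrite !inE rim_within_spoke rim_within_leaf_rim rim_within_leaf // uvF andbT.
have [DF|] := boolP (rim_within (u |: D) F); last by rewrite !andbF.
rewrite !andbT; apply: spanning_tree_triangle => //.
apply: (@rim_within_isolated D) => //; last by rewrite in_setD1 eqxx.
apply/rim_withinP => w y wD; rewrite in_setD1 negb_and.
have : rim_within D F by rewrite rim_within_leaf // DF uvF.
by move/rim_withinP => -> //; rewrite orbT.
Qed.

(** The three classes are: spoke of [u] only, [uv] only, and both; the first is [cone_trees D]
    itself. *)
Lemma card_cone_trees_split (R : pred {set {set Cone G}}) :
  #|[set F in cone_trees (u |: D) | R F]| =
  #|[set F in cone_trees D | R F]| +
  #|[set F in cone_trees (u |: D) |
      [&& rim u v \in F, spoke u \notin F & R F]]| +
  #|[set F in cone_trees (u |: D) |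
      [&& rim u v \in F, spoke u \in F & R F]]|.
Proof.
rewrite -(cardsID [set F : {set {set Cone G}} | rim u v \in F]) addnC -addnA.
congr (_ + _).
  apply: eq_card => F; have := cone_trees_leaf F; rewrite !inE => ->.
  by case: (spanning_tree F); case: (rim u v \in F); rewrite ?andbF ?andbT.
rewrite -(cardsID [set F : {set {set Cone G}} | spoke u \in F]) addnC.
congr (_ + _); apply: eq_card => F; rewrite !inE;
  by case: (spanning_tree F); case: (rim u v \in F); case: (spoke u \in F);
     rewrite ?andbF ?andbT.
Qed.

Lemma card_cone_trees_leaf :
  #|cone_trees (u |: D)| =
  2 * #|cone_trees D| + #|[set F in cone_trees D | spoke v \in F]|.
Proof.
have TE D' : cone_trees D' = [set F in cone_trees D' | xpredT F].
  by apply/setP => F; rewrite inE andbT.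
rewrite TE card_cone_trees_split card_cone_trees_rim // -TE mul2n -addnn.
rewrite -card_cone_trees_triangle; congr (_ + _).
by apply: eq_card => F; rewrite !inE andbT.
Qed.

Lemma card_cone_trees_leaf_center :
  #|[set F in cone_trees (u |: D) | spoke v \in F]| =
  2 * #|[set F in cone_trees D | spoke v \in F]|.
Proof.
have nuv : u != v by apply: contraNneq uD => ->.
rewrite card_cone_trees_split card_cone_trees_rim => [|F]; last first.
  rewrite !in_setU1 (negPf (spoke_neq_rim _ _ _)).
  by rewrite (inj_eq spoke_inj) eq_sym (negPf nuv).
(* The third class is empty: [uv] and both spokes would form a triangle. *)
rewrite [X in _ + X](_ : _ = 0) ?addn0 ?mul2n ?addnn //.
apply: eq_card0 => F; rewrite !inE; apply/negP => /and4P[/andP[tF _] uvF uF].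
by apply/negP; apply: spanning_tree_no_triangle.
Qed.

(** The class without the spoke of [u] drops out, and in [cone_trees D] the spoke of [u] is
    automatic. *)
Lemma card_cone_trees_leaf_tip :
  #|[set F in cone_trees (u |: D) | spoke u \in F]| =
  #|cone_trees D| + #|[set F in cone_trees D | spoke v \in F]|.
Proof.
rewrite card_cone_trees_split -card_cone_trees_triangle -addnA; congr (_ + _).
  apply: eq_card => F; rewrite inE andb_idr //.
  exact: cone_trees_spoke.
rewrite [X in X + _](_ : _ = 0) ?add0n.
  by apply: eq_card => F; rewrite !inE andbb.
by apply: eq_card0 => F; rewrite !inE; case: (spoke u \in F); rewrite !andbF.
Qed.

End AddLeaf.

(** * The base case, the full set, and repeated leaves at one vertex *)

Definition star : {set {set Cone G}} := [set spoke v | v in G].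

Lemma star_rim u v : rim u v \notin star.
Proof.
by apply/imsetP => -[w _ /eqP]; rewrite eq_sym (negPf (spoke_neq_rim _ _ _)).
Qed.

Lemma spanning_tree_star : spanning_tree star.
Proof.
apply/spanning_tree_minimal; split.
- by apply/subsetP => _ /imsetP[v _ ->]; rewrite mem_edges.
- have cN (x : Cone G) : connect (edge_rel star) x None.
    by case: x => [v|]; [apply/connect_edge/imset_f | apply: connect0].
  apply/connected_byP => x y; apply: connect_trans (cN x) _.
  by rewrite connect_edge_sym.
move=> _ /imsetP[v _ ->].
apply: (@connected_by_isolated _ _ (Some v : Cone G) None) => // -[y|].
  by rewrite in_setD1 (negPf (star_rim _ _)) andbF.
by rewrite in_setD1 eqxx.
Qed.

Lemma cone_trees1 v : cone_trees [set v] = [set star].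
Proof.
apply/setP => F; rewrite in_set1; apply/idP/eqP => [|->]; last first.
  by rewrite inE spanning_tree_star; apply/rim_withinP => *; apply: star_rim.
rewrite inE => /andP[tF /rim_withinP vF]; have /and3P[/subsetP sF _ _] := tF.
have rF w y : rim w y \notin F.
  have [wv|wv] := eqVneq w v; last by apply: vF; rewrite in_set1.
  have [yv|yv] := eqVneq y v; last by rewrite rimC vF // in_set1.
  by apply/negP => /sF; rewrite mem_edges wv yv adj_irrefl.
(* With no rim edges at all, every vertex counts as outside [D], which forces every spoke. *)
have F0 : F \in cone_trees set0 by rewrite inE tF; apply/rim_withinP.
apply/eqP; rewrite eqEsubset; apply/andP; split; apply/subsetP => e.
  move=> eF; have /imset2P[x y _ + eE] := sF _ eF.
  case: x y eE => [x|] [y|] eE //; rewrite eE in eF *.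
  - by rewrite (negPf (rF _ _)) in eF.
  - by move=> _; apply: imset_f.
  - by move=> _; rewrite setUC; apply: imset_f.
by case/imsetP=> w _ ->; apply: cone_trees_spoke F0; rewrite in_set0.
Qed.

Lemma card_cone_trees1_spoke v :
  #|[set F in cone_trees [set v] | spoke v \in F]| = 1.
Proof.
rewrite cone_trees1 -(cards1 star); apply: eq_card => F.
by rewrite !inE andb_idr // => /eqP ->; apply: imset_f.
Qed.

Lemma cone_trees_setT : #|cone_trees setT| = tau (Cone G).
Proof.
apply: eq_card => F; rewrite !inE andb_idr // => _.
by apply/rim_withinP => w y; rewrite inE.
Qed.

(** Solves [A' = 2A], [T' = 2T + A]. The equation for [T] is doubled to avoid the exponent
    [n - 1]. *)
Lemma card_cone_trees_leaves (D : nat -> {set G}) v n :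
  v \in D 0 ->
  (forall j, j < n -> exists u, [/\ u \notin D j, D j.+1 = u |: D j, adj u v &
     forall y, y \in D j -> adj u y -> y = v]) ->
  let T j := #|cone_trees (D j)| in
  let A j := #|[set F in cone_trees (D j) | spoke v \in F]| in
  A n = 2 ^ n * A 0 /\ 2 * T n = 2 ^ n * (2 * T 0 + n * A 0).
Proof.
move=> vD + T A; elim: n => [|n IHn] Dn; first by rewrite expn0 !mul1n addn0.
have [|An Tn] := IHn; first by move=> j jn; apply/Dn/ltnW.
have vDn : v \in D n.
  elim: n Dn {IHn An Tn} => // n IHn Dn.
  have [u [_ -> _ _]] := Dn n (ltnW (ltnSn _)).
  by rewrite in_setU1 IHn ?orbT // => j jn; apply/Dn/ltnW.
have [u [uD DE uv u_leaf]] := Dn n (ltnSn n).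
have AS : A n.+1 = 2 * A n.
  by rewrite /A DE; apply: card_cone_trees_leaf_center.
have TS : T n.+1 = 2 * T n + A n by rewrite /T DE; apply: card_cone_trees_leaf.
by rewrite AS TS expnS mulnDr Tn An; split; lia.
Qed.

End ConeTrees.

(** * Building the bi-coconut tree in stages *)

Lemma b_pairSS s1 n x y :
  b_pair s1 n = (x, y) -> b_pair s1 n.+2 = (y + x, y + x + y).
Proof. by move=> /= ->. Qed.

Section BiCoconut.

Variables p s1 s2 : nat.
Local Notation G := (bicoconut p.+1 s1 s2).

(** Holds the first [k] path vertices, [i] leaves at the start and [j] at the end. The path has
    [p.+1] vertices, so its ordinal type is inhabited, as [inord] requires. *)
Definition stage k i j : {set G} :=
  [set z : bicoconut_vertex p.+1 s1 s2 | match z with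
    | inl (inl x) => x < k
    | inl (inr x) => x < i
    | inr x => x < j
    end].

Definition path_vertex k : G := inl (inl (inord k : 'I_p.+1)).

Lemma stage_start : stage 1 0 0 = [set path_vertex 0].
Proof.
apply/setP; case=> [[x|x]|x]; rewrite !inE //.
by rewrite ltnS leqn0 /eq_op /= /eq_op /= /eq_op /= inordK.
Qed.

Lemma stage_full : stage p.+1 s1 s2 = setT.
Proof. by apply/setP; case=> [[x|x]|x]; rewrite !inE ltn_ord. Qed.

Lemma stage_path k i j :
  k <= p -> stage k.+1 i j = path_vertex k |: stage k i j.
Proof.
move=> kp; apply/setP; case=> [[x|x]|x]; rewrite !inE //.
by rewrite ltnS leq_eqVlt {2}/eq_op /= {2}/eq_op /= {2}/eq_op /= inordK.
Qed.

Lemma stage_leaf1 k j (x : 'I_s1) :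
  stage k x.+1 j = (inl (inr x) : G) |: stage k x j.
Proof.
by apply/setP; case=> [[y|y]|y]; rewrite !inE // ltnS leq_eqVlt.
Qed.

Lemma stage_leaf2 k i (x : 'I_s2) :
  stage k i x.+1 = (inr x : G) |: stage k i x.
Proof.
by apply/setP; case=> [[y|y]|y]; rewrite !inE // ltnS leq_eqVlt.
Qed.

Lemma card_cone_trees_stage1 :
  #|[set F in cone_trees (stage 1 s1 0) | spoke (path_vertex 0) \in F]| =
    2 ^ s1 /\
  2 * #|cone_trees (stage 1 s1 0)| = 2 ^ s1 * (s1 + 2).
Proof.
have [||] := @card_cone_trees_leaves G (fun i => stage 1 i 0) (path_vertex 0) s1.
- by rewrite stage_start set11.
- move=> j js; exists (inl (inr (Ordinal js)) : G); split.
  + by rewrite inE ltnn.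
  + exact: (stage_leaf1 1 0 (Ordinal js)).
  + by rewrite /= /bicoconut_adj /= inordK.
  case=> [[y|y]|y]; rewrite !inE // ltnS leqn0 => /eqP y0 _.
  by do 2!congr inl; apply: val_inj; rewrite /= inordK.
rewrite stage_start card_cone_trees1_spoke cone_trees1 cards1.
by move=> -> ->; rewrite !muln1; split=> //; rewrite addnC.
Qed.

(** The pair is [(A, T)] at the current end of the path. A new path vertex sends it to
    [(T + A, 2T + A)], which is two Fibonacci steps. *)
Lemma card_cone_trees_stage2 k :
  0 < s1 -> k <= p ->
  b_pair s1 (2 * k) =
  (#|[set F in cone_trees (stage k.+1 s1 0) | spoke (path_vertex k) \in F]|,
   #|cone_trees (stage k.+1 s1 0)|).
Proof.
move=> s10; elim: k => [_|k IHk kp].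
  have [-> T1] := card_cone_trees_stage1.
  rewrite muln0 /=; congr (_, _).
  by apply/eqP; rewrite -(eqn_pmul2l (isT : 0 < 2)) T1 mulnA -expnS subn1 prednK.
rewrite mulnS add2n (b_pairSS (IHk (ltnW kp))) (stage_path _ _ kp).
have uv : adj (path_vertex k.+1) (path_vertex k).
  by rewrite /= /bicoconut_adj /= !inordK ?eqxx ?orbT // ltnW.
have uD : path_vertex k.+1 \notin stage k.+1 s1 0 by rewrite inE /= inordK // ltnn.
have vD : path_vertex k \in stage k.+1 s1 0 by rewrite inE /= inordK // ltnW.
have u_leaf y : y \in stage k.+1 s1 0 -> adj (path_vertex k.+1) y ->
    y = path_vertex k.
  case: y => [[y|y]|y]; rewrite inE // => yk; rewrite /adj /= /bicoconut_adj /=.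
    rewrite !inordK // => /orP[] /eqP yE; first by rewrite -yE ltnNge leqW in yk.
    by case: yE => yE; do 2!congr inl; apply: val_inj; rewrite /= inordK // ltnW.
  by rewrite inordK.
rewrite (card_cone_trees_leaf uD vD uv u_leaf).
rewrite (card_cone_trees_leaf_tip uD vD uv u_leaf).
by congr (_, _); lia.
Qed.

Lemma card_cone_trees_stage3 :
  2 * #|cone_trees (stage p.+1 s1 s2)| =
  2 ^ s2 * (2 * #|cone_trees (stage p.+1 s1 0)| +
    s2 * #|[set F in cone_trees (stage p.+1 s1 0) | spoke (path_vertex p) \in F]|).
Proof.
have [||_ ->] // :=
  @card_cone_trees_leaves G (fun j => stage p.+1 s1 j) (path_vertex p) s2.
  by rewrite inE /= inordK.
move=> j js; exists (inr (Ordinal js) : G); split.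
- by rewrite inE ltnn.
- exact: (stage_leaf2 p.+1 s1 (Ordinal js)).
- by rewrite /= /bicoconut_adj /= inordK ?eqxx ?orbT.
case=> [[y|y]|y]; rewrite !inE // => _; rewrite /= /bicoconut_adj //= => /eqP [yp].
by do 2!congr inl; apply: val_inj; rewrite /= inordK.
Qed.

End BiCoconut.

(** * Matching the count with the closed formula *)

Lemma b_pair_even s1 p :
  (b s1 (2 * p.+1%:Z - 4)%R, b s1 (2 * p.+1%:Z - 3)%R) = b_pair s1 (2 * p).
Proof.
(* The shift by 2 in [b] turns [2(p+1) - 4] into [2p]; the other index is one higher, and the first
   entry of the next pair is the second of this one. *)
rewrite /b (_ : absz _ = 2 * p); last by lia.
rewrite (_ : absz _ = (2 * p).+1); last by lia.
by rewrite /=; case: (b_pair _ _).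
Qed.

Theorem theorem1p1 (p s1 s2 : nat) (hp : 1 <= p) (hs1 : 1 <= s1)
    (hs2 : 1 <= s2) :
  tau (Cone (bicoconut p s1 s2)) = t p s1 s2.
Proof.
(* Doubling both sides turns [2 ^ (s2 - 1)] into [2 ^ s2], which uses [s2 >= 1]. *)
case: p hp => // p _; apply/eqP; rewrite -(eqn_pmul2l (isT : 0 < 2)).
rewrite -cone_trees_setT -stage_full card_cone_trees_stage3 /t.
have := b_pair_even s1 p; rewrite (card_cone_trees_stage2 s2 hs1 (leqnn p)).
by case=> -> ->; rewrite mulnA -expnS subn1 prednK.
Qed.
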